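(* For $a \in \bar{\mathbb{Q}}$ let $C_{224,a} \subset \mathbb{P}^4$, with homogeneous coordinates $(q:r:s:t:z)$, be the curve \[ V\big(az^2 - t^2 - (tz - s^2),\; az^2 - t^2 - (sz - q^2),\; az^2 - t^2 - (-sz - r^2)\big). \] The values $a$ for which $C_{224,a}$ is singular are exactly $a \in \{-\tfrac14, 0, a_1, a_2, a_3\}$, where $a_1, a_2, a_3$ are the three $3^{\mathrm{rd}}$ critical values of $f_c$.
   Context: $f_c(x) = x^2 + c$. An element $a$ is an $N^{\mathrm{th}}$ critical value of $f_c$ if there exists $c_0$ with $f_{c_0}^N(0) = a$ and $\frac{d}{dc} f_c^N(0)|_{c=c_0} = 0$. The three $3^{\mathrm{rd}}$ critical values are $a = (c^2+c)^2 + c$ for $c$ a root of $4c^3 + 6c^2 + 2c + 1$. The curve $C_{224,a}$ parametrizes $c$ for which $a$ has rational pre-images $\pm t$, $\pm s$ (with $s^2 + c = t$), and $\pm q, \pm r$ (with $q^2 + c = s$, $r^2 + c = -s$). *)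

(* Defs.v *)
From HB Require Import structures.
From mathcomp Require Import all_boot all_order all_algebra all_field.
From mathcomp Require Import mpoly.

Set Implicit Arguments.
Unset Strict Implicit.
Unset Printing Implicit Defensive.

Import GRing.Theory.
Local Open Scope ring_scope.

Definition fquad (R : pzSemiRingType) (c x : R) : R := x ^+ 2 + c.

(* [iter N (fquad 'X) 0] is f_c^N(0) as a polynomial in the indeterminate c. *)
Definition critical_value (N : nat) (a : algC) : Prop :=
  exists2 c0 : algC,
    iter N (fquad c0) 0 = a & (iter N (fquad 'X) 0)^`().[c0] = 0.

(* Projective space of dimension n over K: a point is represented by a nonzero
   row vector of n.+1 homogeneous coordinates. The notions below do not depend
   on the representative as long as the polynomials are homogeneous. *)
Section ProjectiveZeroLocus.

Variables (K : fieldType) (n m : nat) (F : m.-tuple {mpoly K[n.+1]}).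

Definition on_zero_locus (P : 'rV[K]_n.+1) : Prop :=
  P != 0 /\ forall i : 'I_m, (tnth F i).@[P 0] = 0.

Definition jacobian (P : 'rV[K]_n.+1) : 'M[K]_(m, n.+1) :=
  \matrix_(i, j) ((tnth F i)^`M(j)).@[P 0].

(* Jacobian criterion, for V(F) of pure dimension d: P is singular when the
   rank of the Jacobian matrix is less than the codimension n - d. By Euler's
   relation the matrix of all n.+1 homogeneous partials has the same rank at a
   point of V(F) as the one computed in an affine chart. *)
Definition singular_point (d : nat) (P : 'rV[K]_n.+1) : Prop :=
  on_zero_locus P /\ (\rank (jacobian P) < n - d)%N.

Definition singular_locus_nonempty (d : nat) : Prop :=
  exists P : 'rV[K]_n.+1, singular_point d P.

End ProjectiveZeroLocus.

Definition C224 (a : algC) : 3.-tuple {mpoly algC[5]} :=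
  let q := 'X_(@Ordinal 5 0 isT) in
  let r := 'X_(@Ordinal 5 1 isT) in
  let s := 'X_(@Ordinal 5 2 isT) in
  let t := 'X_(@Ordinal 5 3 isT) in
  let z := 'X_(@Ordinal 5 4 isT) in
  [tuple a *: z ^+ 2 - t ^+ 2 - (t * z - s ^+ 2);
         a *: z ^+ 2 - t ^+ 2 - (s * z - q ^+ 2);
         a *: z ^+ 2 - t ^+ 2 - (- (s * z) - r ^+ 2)].

(* The hyperplane z = 0 meets V(C224 a) in the eight points with
   q^2 = r^2 = s^2 = t^2, so V(C224 a) is a complete intersection of pure
   dimension 1 for every a, and the codimension in the criterion is 3. *)
Definition C224_singular (a : algC) : Prop := singular_locus_nonempty (C224 a) 1.

(* Main.v *)
(* A singular point has a nonzero left kernel vector (u1, u2, u3) of its Jacobian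
   matrix, and none lies at infinity. In the chart z = 1 the first two columns
   give q u2 = r u3 = 0. If q, r <> 0 then s = 0 and t = -1/2, so a = -1/4; if
   q = r = 0 then s = t = a = 0; if exactly one of q, r vanishes then
   c = a - t^2 is s or -s, the remaining columns say 4c^3 + 6c^2 + 2c + 1 = 0,
   and a = (c^2 + c)^2 + c is a third critical value. *)
Require Import Defs.
From HB Require Import structures.
From mathcomp Require Import all_boot all_order all_algebra all_field.
From mathcomp Require Import mpoly ring.

Set Implicit Arguments.
Unset Strict Implicit.
Unset Printing Implicit Defensive.

Import GRing.Theory Num.Theory.
Local Open Scope ring_scope.

(** * Left kernels and partial derivatives of coordinates *)

Lemma rank_lt_rowsP (F : fieldType) m n (A : 'M[F]_(m, n)) :
  reflect (exists2 u : 'rV_m, u != 0 & u *m A = 0) (\rank A < m)%N.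
Proof.
rewrite ltn_neqAle rank_leq_row andbT -[_ == m]/(row_free A) -kermx_eq0.
apply: (iffP rowV0Pn) => [[u /sub_kermxP uA u0]|[u u0 uA]]; exists u => //.
exact/sub_kermxP.
Qed.

Lemma mderivXU (n : nat) (R : nzRingType) (i j : 'I_n) :
  ('X_j : {mpoly R[n]})^`M(i) = (j == i)%:R.
Proof.
rewrite mderivX mnm1E; case: eqP => [->|_]; last by rewrite scale0r.
have -> : (U_(i) - U_(i))%MM = 0%MM by apply/mnmP=> k; rewrite mnmBE subnn mnm0E.
by rewrite mpolyX0 scale1r.
Qed.

(* The vector (u1, u2, u3) is a dependency between the rows of the Jacobian
   matrix at the point (q : r : s : t : 1) of the curve. *)
Definition affine_singular (a q r s t u1 u2 u3 : algC) : Prop :=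
  [/\ [|| u1 != 0, u2 != 0 | u3 != 0],
      [/\ a - t ^+ 2 = t - s ^+ 2, a - t ^+ 2 = s - q ^+ 2
        & a - t ^+ 2 = - s - r ^+ 2]
    & [/\ q * u2 = 0, r * u3 = 0, 2 * s * u1 - u2 + u3 = 0,
          (2 * t + 1) * u1 + 2 * t * (u2 + u3) = 0
        & (2 * a - t) * u1 + (2 * a - s) * u2 + (2 * a + s) * u3 = 0]].

(** * Explicit equations of the curve and of the left kernel of its Jacobian matrix *)

Section Equations.

Variables (a : algC) (P : 'rV[algC]_5) (u : 'rV[algC]_3).

Let q : algC := P 0 (@Ordinal 5 0 isT).
Let r : algC := P 0 (@Ordinal 5 1 isT).
Let s : algC := P 0 (@Ordinal 5 2 isT).
Let t : algC := P 0 (@Ordinal 5 3 isT).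
Let z : algC := P 0 (@Ordinal 5 4 isT).
Let u1 : algC := u 0 (@Ordinal 3 0 isT).
Let u2 : algC := u 0 (@Ordinal 3 1 isT).
Let u3 : algC := u 0 (@Ordinal 3 2 isT).

Lemma C224_zeroE :
  (forall i, (tnth (C224 a) i).@[P 0] = 0) <->
  [/\ a * z ^+ 2 - t ^+ 2 - (t * z - s ^+ 2) = 0,
      a * z ^+ 2 - t ^+ 2 - (s * z - q ^+ 2) = 0
    & a * z ^+ 2 - t ^+ 2 - (- (s * z) - r ^+ 2) = 0].
Proof.
pose E := (mevalB, mevalN, mevalZ, mevalM, mevalXU, expr2).
split=> [h | [h1 h2 h3] i].
  by have := (h (@Ordinal 3 0 isT), h (@Ordinal 3 1 isT), h (@Ordinal 3 2 isT));
     rewrite /C224 !(tnth_nth 0) /= !E => -[[h1 h2] h3]; split.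
move: h1 h2 h3; rewrite (tnth_nth 0) /=.
by case: i => [[|[|[|//]]] /= _] h1 h2 h3; rewrite !E.
Qed.

Lemma jacobian_C224_kerE :
  u *m jacobian (C224 a) P = 0 <->
  [/\ 2 * q * u2 = 0, 2 * r * u3 = 0, 2 * s * u1 - z * u2 + z * u3 = 0,
      (2 * t + z) * u1 + 2 * t * (u2 + u3) = 0
    & (2 * a * z - t) * u1 + (2 * a * z - s) * u2 + (2 * a * z + s) * u3 = 0].
Proof.
(* All partials in [t] carry a minus sign; it is kept outside the fourth entry and removed at the
   end. *)
have -> : u *m jacobian (C224 a) P =
  \row_j [:: 2 * q * u2; 2 * r * u3; 2 * s * u1 - z * u2 + z * u3;
      - ((2 * t + z) * u1 + 2 * t * (u2 + u3));
      (2 * a * z - t) * u1 + (2 * a * z - s) * u2 + (2 * a * z + s) * u3]`_j.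
  apply/rowP=> j; rewrite !mxE !big_ord_recr big_ord0 /= !mxE !(tnth_nth 0) /=.
  rewrite !(mderivB, mderivN, mderivZ, mderivM, expr2, mderivXU).
  rewrite !(mevalB, mevalD, mevalN, mevalZ, mevalM, mevalXU).
  have -> : widen_ord (leqnSn 2) (widen_ord (leqnSn 1) ord_max)
    = @Ordinal 3 0 isT by apply: val_inj.
  have -> : widen_ord (leqnSn 2) ord_max = @Ordinal 3 1 isT by apply: val_inj.
  have -> : ord_max = @Ordinal 3 2 isT by apply: val_inj.
  rewrite -!/q -!/r -!/s -!/t -!/z -!/u1 -!/u2 -!/u3.
  by case: j => [[|[|[|[|[|//]]]]] /= lt_j]; rewrite !(meval0, meval1); ring.
split=> [/rowP h | [h1 h2 h3 h4 h5]].
  have := (h (@Ordinal 5 0 isT), h (@Ordinal 5 1 isT), h (@Ordinal 5 2 isT),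
           h (@Ordinal 5 3 isT), h (@Ordinal 5 4 isT)).
  rewrite !mxE /= => -[[[[h1 h2] h3] h4] h5]; split=> //.
  by apply/eqP; rewrite -oppr_eq0 h4.
by apply/rowP=> j; rewrite !mxE; case: j => [[|[|[|[|[|//]]]]] /= _];
   rewrite ?h4 ?oppr0.
Qed.

End Equations.


(** This is the derivative in [c] of [(c ^+ 2 + c) ^+ 2 + c], the third iterate of 0. *)
Definition critical_poly (c : algC) : algC :=
  4 * c ^+ 3 + 6 * c ^+ 2 + 2 * c + 1.

(** * Passage to the chart [z = 1] *)

Lemma C224_singular_affine a :
  C224_singular a <-> exists q r s t u1 u2 u3, affine_singular a q r s t u1 u2 u3.
Proof.
split=> [[P [[P0 /C224_zeroE[]]]] | [q [r [s [t [u1 [u2 [u3]]]]]]]].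
- set q := P 0 (@Ordinal 5 0 _); set r := P 0 (@Ordinal 5 1 _).
  set s := P 0 (@Ordinal 5 2 _); set t := P 0 (@Ordinal 5 3 _).
  set z := P 0 (@Ordinal 5 4 _) => e1 e2 e3.
  move=> /rank_lt_rowsP[u u0 /jacobian_C224_kerE[]].
  rewrite -/q -/r -/s -/t -/z.
  set u1 := u 0 (@Ordinal 3 0 _); set u2 := u 0 (@Ordinal 3 1 _).
  set u3 := u 0 (@Ordinal 3 2 _).
  move=> k1 k2 k3 k4 k5.
  have un0 : [|| u1 != 0, u2 != 0 | u3 != 0].
    apply: contraNT u0; rewrite !negb_or !negbK => /and3P[/eqP v1 /eqP v2 /eqP v3].
    apply/eqP/rowP=> i; rewrite mxE.
    by case: i => [[|[|[|//]]] /= lt_i]; rewrite (bool_irrelevance lt_i isT).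
  (* At infinity the squares of [q], [r], [s], [t] agree. If [t = 0] then [P] is zero; otherwise the
     first three columns force [u2], [u3] and [u1] to vanish. *)
  have [z0|z0] := eqVneq z 0.
    rewrite z0 in e1 e2 e3 k3.
    have n2 : 2 != 0 :> algC by rewrite pnatr_eq0.
    have s2 : s ^+ 2 = t ^+ 2 by rewrite -[RHS]addr0 -e1; ring.
    have q2 : q ^+ 2 = t ^+ 2 by rewrite -[RHS]addr0 -e2; ring.
    have r2 : r ^+ 2 = t ^+ 2 by rewrite -[RHS]addr0 -e3; ring.
    have [t0|t0] := eqVneq t 0.
      case/negP: P0; apply/eqP/rowP=> i; rewrite mxE.
      move: s2 q2 r2; rewrite t0 expr0n /= => /eqP + /eqP + /eqP.
      rewrite !sqrf_eq0 => /eqP s0 /eqP q0 /eqP r0.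
      by case: i => [[|[|[|[|[|//]]]]] /= lt_i]; rewrite (bool_irrelevance lt_i isT).
    have nz x : x ^+ 2 = t ^+ 2 -> x != 0.
      by move=> x2; rewrite -sqrf_eq0 x2 sqrf_eq0.
    move: k1 k2 k3 un0; rewrite !mul0r subr0 addr0 => /eqP + /eqP + /eqP.
    rewrite !mulf_eq0 (negbTE n2) (negbTE (nz q q2)) (negbTE (nz r r2)).
    rewrite (negbTE (nz s s2)) /=.
    by move=> -> -> ->.
  (* The same dependency survives scaling: the curve equations are homogeneous of degree 2 in the
     coordinates and the column equations of degree 1. *)
  pose q' := q / z; pose r' := r / z; pose s' := s / z; pose t' := t / z.
  exists q', r', s', t', u1, u2, u3.
  have n2 : 2 != 0 :> algC by rewrite pnatr_eq0.
  split=> //.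
    rewrite /q' /r' /s' /t'; split; apply/eqP; rewrite -subr_eq0; apply/eqP.
    + by rewrite -[RHS](mul0r (z ^- 2)) -e1; field.
    + by rewrite -[RHS](mul0r (z ^- 2)) -e2; field.
    + by rewrite -[RHS](mul0r (z ^- 2)) -e3; field.
  rewrite /q' /r' /s' /t'; split.
  + by rewrite -[RHS](mul0r (2 * z)^-1) -k1; field; rewrite z0.
  + by rewrite -[RHS](mul0r (2 * z)^-1) -k2; field; rewrite z0.
  + by rewrite -[RHS](mul0r z^-1) -k3; field.
  + by rewrite -[RHS](mul0r z^-1) -k4; field.
  + by rewrite -[RHS](mul0r z^-1) -k5; field.
case=> un0 [e1 e2 e3] [k1 k2 k3 k4 k5].
exists (\row_j [:: q; r; s; t; 1]`_j); split; [split|].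
- apply/eqP=> /rowP/(_ (@Ordinal 5 4 isT)); rewrite !mxE /= => /eqP.
  by rewrite oner_eq0.
- apply/C224_zeroE; rewrite !mxE /= !expr1n !mulr1.
  by split; [rewrite e1 | rewrite e2 | rewrite e3]; rewrite subrr.
apply/rank_lt_rowsP; exists (\row_j [:: u1; u2; u3]`_j).
- apply: contraTneq un0 => /rowP un0.
  have := (un0 (@Ordinal 3 0 isT), un0 (@Ordinal 3 1 isT), un0 (@Ordinal 3 2 isT)).
  by rewrite !mxE /= => -[[-> ->] ->]; rewrite eqxx.
apply/jacobian_C224_kerE; rewrite !mxE /= !mul1r !mulr1.
by split=> //; rewrite -mulrA ?k1 ?k2 mulr0.
Qed.

(** * Case analysis on the vanishing of [q] and [r] *)

(** Serves both cases where exactly one of [q], [r] vanishes, with [c] equal to [s] or [- s] and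
    [u], [w] the remaining entries of the dependency. Substituting [w] and [t] turns the [t] column
    into [critical_poly c * u], and [u] is nonzero. *)
Lemma critical_of_dependency (a c t u w : algC) :
    (u != 0) || (w != 0) -> w = 2 * c * u -> (2 * t + 1) * u + 2 * t * w = 0 ->
    a - t ^+ 2 = c -> t = c ^+ 2 + c ->
  critical_poly c = 0 /\ a = (c ^+ 2 + c) ^+ 2 + c.
Proof.
move=> un0 wE dep aE tE; split; last by rewrite -tE -aE; ring.
have {}un0 : u != 0 by apply: contraTneq un0 => u0; rewrite wE u0 mulr0 eqxx.
by apply: (mulIf un0); rewrite mul0r -dep wE tE /critical_poly; ring.
Qed.

Lemma affine_singularP a :
  (exists q r s t u1 u2 u3, affine_singular a q r s t u1 u2 u3) <->
  [\/ a = - 4^-1, a = 0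
    | exists2 c, critical_poly c = 0 & a = (c ^+ 2 + c) ^+ 2 + c].
Proof.
have n2 : 2 != 0 :> algC by rewrite pnatr_eq0.
split=> [[q [r [s [t [u1 [u2 [u3 [un0 [e1 e2 e3] [k1 k2 k3 k4 k5]]]]]]]]] | ].
- have tE : t = s ^+ 2 + (a - t ^+ 2) by rewrite e1; ring.
  have [q0|q0] := eqVneq q 0; have [r0|r0] := eqVneq r 0.
  + have s0 : s = 0.
      apply: (mulfI n2); rewrite mulr0.
      have -> : 2 * s = (s - q ^+ 2) - (- s - r ^+ 2) by rewrite q0 r0; ring.
      by rewrite -e2 -e3 subrr.
    have c0 : a - t ^+ 2 = 0 by rewrite e2 s0 q0; ring.
    apply: Or32; rewrite -[a](subrK (t ^+ 2)) c0 tE c0 s0; ring.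
  + move/eqP: k2; rewrite mulf_eq0 (negbTE r0) => /eqP u30; subst u3.
    have cE : a - t ^+ 2 = s by rewrite e2 q0; ring.
    have [] := @critical_of_dependency a s t u1 u2.
    * by rewrite eqxx orbF in un0.
    * by apply/eqP; rewrite -subr_eq0 -oppr_eq0 -k3; apply/eqP; ring.
    * by rewrite -k4; ring.
    * exact: cE.
    * by rewrite {1}tE cE.
    by move=> cs aE; apply: Or33; exists s.
  + move/eqP: k1; rewrite mulf_eq0 (negbTE q0) => /eqP u20; subst u2.
    have cE : a - t ^+ 2 = - s by rewrite e3 r0; ring.
    have [] := @critical_of_dependency a (- s) t u1 u3.
    * by rewrite eqxx in un0.
    * by apply/eqP; rewrite -subr_eq0 -k3; apply/eqP; ring.
    * by rewrite -k4; ring.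
    * exact: cE.
    * by rewrite {1}tE cE sqrrN.
    by move=> cs aE; apply: Or33; exists (- s).
  + move/eqP: k1; rewrite mulf_eq0 (negbTE q0) => /eqP u20; subst u2.
    move/eqP: k2; rewrite mulf_eq0 (negbTE r0) => /eqP u30; subst u3.
    rewrite eqxx !orbF in un0.
    (* Only [u1] is left, so the [t] and [z] columns of the first row vanish; together they give
       [4 * a = - 1]. *)
    have t2 : 2 * t + 1 = 0 by apply: (mulIf un0); rewrite mul0r -k4; ring.
    have at0 : 2 * a - t = 0 by apply: (mulIf un0); rewrite mul0r -k5; ring.
    apply: Or31; apply: (mulfI n2); apply: (mulfI n2).
    have -> : 2 * (2 * a) = 2 * (2 * a - t) + (2 * t + 1) - 1 by ring.
    by rewrite at0 t2; field.
- case=> [-> | -> | [c cr ->]].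
  (* Here the first row of the Jacobian matrix is zero. *)
  + exists (sqrtC 2^-1), (sqrtC 2^-1), 0, (- 2^-1), 1, 0, 0.
    split; first by rewrite oner_neq0.
      by rewrite !sqrtCK; split; field.
    by split; field.
  + exists 0, 0, 0, 0, 0, 1, 1; split; first by rewrite oner_neq0 !orbT.
      by split; ring.
    by split; ring.
  (* The choice [q = 0] gives [s = c], then [r ^+ 2 = - 2 * c]; the third column dictates the
     dependency [(1, 2 * c, 0)]. *)
  + exists 0, (sqrtC (- 2 * c)), c, (c ^+ 2 + c), 1, (2 * c), 0.
    split; first by rewrite oner_neq0.
      by rewrite !sqrtCK; split; ring.
    split; try by ring.
      by rewrite -[RHS]cr /critical_poly; ring.
    (* By Euler's relation the [z] column is [t] times the preceding equation, where
       [t = c ^+ 2 + c]. *)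
    have -> : (2 * ((c ^+ 2 + c) ^+ 2 + c) - (c ^+ 2 + c)) * 1
      + (2 * ((c ^+ 2 + c) ^+ 2 + c) - c) * (2 * c)
      + (2 * ((c ^+ 2 + c) ^+ 2 + c) + c) * 0
      = (c ^+ 2 + c) * critical_poly c by rewrite /critical_poly; ring.
    by rewrite cr mulr0.
Qed.

(** * The third critical values and their distinctness *)

Lemma critical_value3P a :
  critical_value 3 a <->
  exists2 c, critical_poly c = 0 & a = (c ^+ 2 + c) ^+ 2 + c.
Proof.
have dE c : (iter 3 (fquad 'X) 0)^`().[c] = critical_poly c.
  rewrite /= /fquad expr0n add0r !(derivD, derivM, derivX, expr2) !hornerE.
  by rewrite /critical_poly; ring.
have iE c : iter 3 (fquad c) 0 = (c ^+ 2 + c) ^+ 2 + c.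
  by rewrite /= /fquad expr0n add0r.
by split=> [[c <-]|[c cr ->]]; [rewrite dE | ]; exists c; rewrite ?dE ?iE.
Qed.

Lemma critical_poly_roots :
  exists x y z : algC, uniq [:: x; y; z] /\
    forall c, critical_poly c = 4 * (c - x) * (c - y) * (c - z).
Proof.
pose p : {poly algC} := Poly [:: 1; 2; 6; 4].
have n0 n : n.+1%:R != 0 :> algC by rewrite pnatr_eq0.
have pE : p = [:: 1; 2; 6; 4] :> seq algC by rewrite (@PolyK _ 0) //= n0.
have [rs rsE] := closed_field_poly_normal p.
have lp : lead_coef p = 4 by rewrite lead_coefE pE.
have : size p = (size rs).+1.
  by rewrite rsE size_scale ?size_prod_XsubC // lp n0.
rewrite pE; case: rs rsE => [|x [|y [|z [|]]]] //= rsE _.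
have cE c : critical_poly c = 4 * (c - x) * (c - y) * (c - z).
  have -> : critical_poly c = p.[c].
    by rewrite horner_Poly /= /critical_poly; ring.
  by rewrite rsE lp !big_cons big_nil mulr1 hornerZ !hornerM !hornerXsubC !mulrA.
exists x, y, z; split=> //.
have no_double x1 x2 :
    (forall c, critical_poly c = 4 * (c - x1) * (c - x1) * (c - x2)) -> False.
  move=> E.
  have V c : critical_poly c - 4 * (c - x1) * (c - x1) * (c - x2) = 0.
    by rewrite E subrr.
  have /eqP : 13 = 0 :> algC.
    (* Half the derivative of [critical_poly] vanishes at a double root. The difference of the two
       cubics is at most quadratic, so its derivative is recovered from its values at 1, -1 and
       0. *)
    have D : 6 * x1 ^+ 2 + 6 * x1 + 1 = 0.
      pose e1 := critical_poly 1 - 4 * (1 - x1) * (1 - x1) * (1 - x2).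
      pose e2 := critical_poly (- 1) - 4 * (- 1 - x1) * (- 1 - x1) * (- 1 - x2).
      pose e0 := critical_poly 0 - 4 * (0 - x1) * (0 - x1) * (0 - x2).
      have -> : 6 * x1 ^+ 2 + 6 * x1 + 1
          = x1 * (e1 + e2 - 2 * e0) / 2 + (e1 - e2) / 4.
        by rewrite /e1 /e2 /e0 /critical_poly; field.
      by rewrite /e1 /e2 /e0 !V; ring.
    have px1 : critical_poly x1 = 0 by rewrite E; ring.
    (* Euclid's algorithm: the cubic leaves remainder [2 * (1 - x1) / 3] modulo the half derivative,
       whose value at 1 is 13. *)
    have -> : 13 = 6 * x1 ^+ 2 + 6 * x1 + 1 + (6 * x1 + 12) * (3 / 2) *
        (critical_poly x1 - (6 * x1 ^+ 2 + 6 * x1 + 1) * (2 * x1 + 1) / 3).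
      by rewrite /critical_poly; field.
    by rewrite D px1; ring.
  by rewrite (negbTE (n0 12)).
rewrite /= !inE negb_or andbT -andbA; apply/and3P; split; apply/eqP=> e.
- by apply: (no_double x z) => c; rewrite cE e; ring.
- by apply: (no_double x y) => c; rewrite cE -e; ring.
- by apply: (no_double z x) => c; rewrite cE e; ring.
Qed.

(** Makes the three critical values distinct: two different roots with equal values would have sum
    2, which the cubic excludes. *)
Lemma critical_value_inj c d :
    critical_poly c = 0 -> critical_poly d = 0 ->
    (c ^+ 2 + c) ^+ 2 + c = (d ^+ 2 + d) ^+ 2 + d ->
  c = d.
Proof.
move=> pc pd; have [// | ncd] := eqVneq c d; rewrite -subr_eq0 in ncd.
have n0 n : n.+1%:R != 0 :> algC by rewrite pnatr_eq0.
(* The quartic modulo the cubic is quadratic, so [e] determines [c + d]. *)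
have red x : critical_poly x = 0 ->
    (x ^+ 2 + x) ^+ 2 + x = - (x ^+ 2 - 2 * x + 2^-1) / 4.
  move=> px; have -> : (x ^+ 2 + x) ^+ 2 + x
    = critical_poly x * (x / 4 + 8^-1) - (x ^+ 2 - 2 * x + 2^-1) / 4.
    by rewrite /critical_poly; field.
  by rewrite px; ring.
rewrite !red // => e.
have sum : c + d - 2 = 0.
  apply: (mulIf ncd); rewrite mul0r.
  have -> : (c + d - 2) * (c - d) = 4 * (- (d ^+ 2 - 2 * d + 2^-1) / 4
    - - (c ^+ 2 - 2 * c + 2^-1) / 4) by field.
  by rewrite e subrr mulr0.
(* The divided difference of [critical_poly] at [c] and [d]. *)
have quo : 4 * (c ^+ 2 + c * d + d ^+ 2) + 6 * (c + d) + 2 = 0.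
  apply: (mulIf ncd); rewrite mul0r -[RHS](subrr 0) -{1}pc -pd.
  by rewrite /critical_poly; ring.
have dE : d = 2 - c by apply/eqP; rewrite -subr_eq0 -sum; apply/eqP; ring.
have /eqP : 104 = 0 :> algC; last by rewrite (negbTE (n0 103)).
(* With [d = 2 - c] the divided difference is [4 * c ^+ 2 - 8 * c + 30]; dividing the cubic by it
   gives quotient [c + 7 / 2] and remainder -104. *)
have -> : 104 = (c + 7 / 2) * (4 * (c ^+ 2 + c * d + d ^+ 2) + 6 * (c + d) + 2)
    - critical_poly c by rewrite dE /critical_poly; field.
by rewrite quo pc; ring.
Qed.

Theorem theorem4p3 :
  exists a1 a2 a3 : algC,
    [/\ uniq [:: a1; a2; a3],
        forall a : algC, critical_value 3 a <-> a \in [:: a1; a2; a3]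
      & forall a : algC,
          C224_singular a <-> a \in [:: - 4^-1; 0; a1; a2; a3]].
Proof.
have [x [y [z [rs_uniq pE]]]] := critical_poly_roots.
pose f (c : algC) := (c ^+ 2 + c) ^+ 2 + c.
have rootE c : critical_poly c = 0 <-> c \in [:: x; y; z].
  rewrite pE; split=> [/eqP|].
    by rewrite !mulf_eq0 pnatr_eq0 /= !subr_eq0 !inE orbA.
  by rewrite !inE => /or3P[] /eqP->; ring.
have critE a : critical_value 3 a <-> a \in map f [:: x; y; z].
  apply: (iff_trans (critical_value3P a)).
  split=> [[c /rootE cr ->] | /mapP[c /rootE cr ->]]; last by exists c.
  exact: (map_f f cr).
exists (f x), (f y), (f z); split.
- rewrite -[[:: f x; f y; f z]]/(map f [:: x; y; z]) map_inj_in_uniq //.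
  by move=> c d /rootE pc /rootE pd; apply: critical_value_inj.
- exact: critE.
- move=> a; rewrite 2!inE.
  apply: (iff_trans (C224_singular_affine a)).
  apply: (iff_trans (affine_singularP a)).
  split=> [[->|->|/critical_value3P/critE h]|].
  + by rewrite eqxx.
  + by rewrite eqxx orbT.
  + by rewrite [_ \in _]h !orbT.
  + case/or3P => [/eqP->|/eqP->|h]; [exact: Or31|exact: Or32|apply: Or33].
    exact/critical_value3P/critE.
Qed.
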